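(* Let $\mathbb{T}$ be a time scale, let $a,b\in\mathbb{T}$ with $a<b$, and let $I_{\mathbb{T}}=[a,b]\cap\mathbb{T}$. Let $f\in C_{rd}(I_{\mathbb{T}},\mathbb{R})$, and let $k\in C_{rd}(I_{\mathbb{T}}\times I_{\mathbb{T}}\times\mathbb{R},\mathbb{R})$ be non-decreasing in its third argument. Assume that there exists $L\ge 0$ such that $$|k(t,s,p)-k(t,s,q)|\le L|p-q|\qquad\text{for all }(t,s)\in I_{\mathbb{T}}\times I_{\mathbb{T}},\ p,q\in\mathbb{R}.$$ Let $v,w\in C_{rd}(I_{\mathbb{T}},\mathbb{R})$ be, respectively, a lower and an upper solution of the integral equation $$x(t)=f(t)+\int_a^t k(t,s,x(s))\,\Delta s,\qquad t\in I_{\mathbb{T}},$$ that is, for all $t\in I_{\mathbb{T}}$, $$v(t)\le f(t)+\int_a^t k(t,s,v(s))\,\Delta s\quad\text{and}\quad w(t)\ge f(t)+\int_a^t k(t,s,w(s))\,\Delta s ,$$ and suppose $v(t)\le w(t)$ for all $t\in I_{\mathbb{T}}$. Define $$x_0(t)=f(t)+\int_a^t k(t,s,v(s))\,\Delta s,\qquad x_n(t)=f(t)+\int_a^t k(t,s,x_{n-1}(s))\,\Delta s,\quad n=1,2,\dots$$ for $t\in I_{\mathbb{T}}$. Then the integral equation has a unique solution $x\in C_{rd}(I_{\mathbb{T}},\mathbb{R})$, the sequence $(x_n)$ converges to $x$ uniformly on $I_{\mathbb{T}}$, and $v(t)\le x(t)\le w(t)$ for all $t\in I_{\mathbb{T}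}$.
   Context: A time scale $\mathbb{T}$ is a nonempty closed subset of $\mathbb{R}$. The jump operators are $\sigma(t)=\inf\{s\in\mathbb{T}:s>t\}$ and $\rho(t)=\sup\{s\in\mathbb{T}:s<t\}$. A point $t\in I_{\mathbb{T}}$ is right-dense if $t<b$ and $\sigma(t)=t$, and left-dense if $t>a$ and $\rho(t)=t$. A function $g:I_{\mathbb{T}}\to\mathbb{R}$ is rd-continuous, written $g\in C_{rd}(I_{\mathbb{T}},\mathbb{R})$, if it is continuous at every right-dense point and has a finite left-sided limit at every left-dense point. Rd-continuity of a function $k$ on $I_{\mathbb{T}}\times I_{\mathbb{T}}\times\mathbb{R}$ is understood as follows. For $\tau\in I_{\mathbb{T}}$ let $\mathcal{A}_\tau=\{I_{\mathbb{T}}\}$ if $\tau$ is right-dense. Otherwise let $\mathcal{A}_\tau$ consist of $\{\tau\}$ and, if $\tau$ is left-dense, also of $\{t\in I_{\mathbb{T}}:t<\tau\}$. Then $k\in C_{rd}(I_{\mathbb{T}}\times I_{\mathbb{T}}\times\mathbb{R},\mathbb{R})$ if for all $(t_0,s_0,p_0)$ and all $A\in\mathcal{A}_{t_0}$, $B\in\mathcal{A}_{s_0}$, the limit of $k(t,s,p)$ as $(t,s,p)\to(t_0,s_0,p_0)$ within $A\times B\times\mathbb{R}$ exists and is finite, and it equals $k(t_0,s_0,p_0)$ whenever $t_0\in A$ and $s_0\in B$. The delta derivative $F^\Delta(t)$ is the number such that for every $\varepsilon>0$ there is a neighborhood $U$ of $t$ with $|F(\sigma(t))-F(s)-F^\Delta(t)(\sigma(t)-s)|\le\varepsilon|\sigma(t)-s|$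 for all $s\in U$. The delta integral is $\int_r^s g(t)\,\Delta t=F(s)-F(r)$, where $F$ is an antiderivative of $g$, i.e. $F^\Delta=g$ (at all points except a left-scattered maximum). Every rd-continuous function has an antiderivative.
   Formalization: If b is left-dense, an antiderivative F of g is only required to be continuous at b, not to satisfy F^Δ(b)=g(b); otherwise an rd-continuous g with a jump at b (e.g. T=ℝ, g the indicator of {b}) has no antiderivative and the integrals are undefined. *)

(* Defs.v *)
From HB Require Import structures.
From mathcomp Require Import all_boot all_order all_algebra.
From mathcomp Require Import all_classical all_reals all_analysis.
Set Implicit Arguments.
Unset Strict Implicit.
Unset Printing Implicit Defensive.
Import Order.TTheory GRing.Theory Num.Theory.
Import numFieldNormedType.Exports.
Local Open Scope classical_set_scope.
Local Open Scope ring_scope.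

(* Functions on the time-scale interval I_T = [a, b] `&` T are represented by
   functions on R; every notion below only looks at their values on I_T. *)

Section TimeScale.
Variable R : realType.
Implicit Types (T S A B : set R) (a b t s r : R) (F g x : R -> R)
  (k : R -> R -> R -> R).

Definition time_scale T : Prop := T !=set0 /\ closed T.

Definition ts_interval T a b : set R := `[a, b] `&` T.

(* The values at a maximum (for sigma) and at a minimum (for rho) of T are
   those of inf set0 and sup set0; they are never used below. *)
Definition sigma T t : R := inf [set s | T s /\ t < s].
Definition rho T t : R := sup [set s | T s /\ s < t].

Definition right_dense T b t : Prop := t < b /\ sigma T t = t.
Definition left_dense T a t : Prop := a < t /\ rho T t = t.

Definition rd_continuous T a b g : Prop :=
  forall t, ts_interval T a b t ->
    (right_dense T b t ->
      g s @[s --> within (ts_interval T a b) (nbhs t)] --> g t) /\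
    (left_dense T a t ->
      exists l : R,
        g s @[s --> within (ts_interval T a b `&` [set s | s < t]) (nbhs t)]
          --> l).

(* The family A_t of sides along which limits at t are taken. *)
Definition rd_sides T a b t : set (set R) :=
  [set A | (right_dense T b t /\ A = ts_interval T a b) \/
           (~ right_dense T b t /\
             (A = [set t] \/
              (left_dense T a t /\
               A = ts_interval T a b `&` [set s | s < t])))].

Definition rd_continuous3 T a b k : Prop :=
  forall t0 s0 p0 : R,
    ts_interval T a b t0 -> ts_interval T a b s0 ->
    forall A B : set R, rd_sides T a b t0 A -> rd_sides T a b s0 B ->
    exists2 l : R,
      k z.1.1 z.1.2 z.2 @[z --> within (A `*` B `*` [set: R])
                                  (nbhs (t0, s0, p0))] --> l &
      A t0 -> B s0 -> l = k t0 s0 p0.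

Definition is_delta_derivative S F t (d : R) : Prop :=
  forall e : R, 0 < e ->
    \forall s \near within S (nbhs t),
      `|F (sigma S t) - F s - d * (sigma S t - s)| <= e * `|sigma S t - s|.

(* F is differentiated on the time scale I_T, whose maximum is b. If b is
   left-scattered it is exempted, as usual. If b is left-dense, rd-continuity
   allows g to jump at b, in which case no F with F^Delta = g on [a, b[ has
   F^Delta(b) = g(b) (take T = R and g the indicator of {b}); so that every
   rd-continuous function has an antiderivative, only continuity of F is
   required there. When g is left-continuous at b, F^Delta(b) = g(b) follows.
   Continuity at the other points is implied by differentiability. *)
Definition delta_antiderivative T a b g F : Prop :=
  {within ts_interval T a b, continuous F} /\
  (forall t, ts_interval T a b t -> t < b ->
     is_delta_derivative (ts_interval T a b) F t (g t)).

(* The value F s - F r does not depend on the antiderivative F; the default 0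
   is only taken when g has no antiderivative. *)
Definition delta_integral T a b g r s : R :=
  xget 0 [set F s - F r | F in [set F | delta_antiderivative T a b g F]].

Definition volterra T a b (f : R -> R) k x t : R :=
  f t + delta_integral T a b (fun s => k t s (x s)) a t.

Definition is_solution T a b (f : R -> R) k x : Prop :=
  forall t, ts_interval T a b t -> x t = volterra T a b f k x t.

Definition is_lower_solution T a b (f : R -> R) k (v : R -> R) : Prop :=
  forall t, ts_interval T a b t -> v t <= volterra T a b f k v t.

Definition is_upper_solution T a b (f : R -> R) k (w : R -> R) : Prop :=
  forall t, ts_interval T a b t -> volterra T a b f k w t <= w t.

End TimeScale.

(* Main.v *)
Require Import Defs.
From mathcomp Require Import all_boot all_order all_algebra.
From mathcomp Require Import all_classical all_reals all_analysis.
From mathcomp Require Import lra ring.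
Import Order.TTheory GRing.Theory Num.Theory.
Import numFieldNormedType.Exports.
Local Open Scope classical_set_scope.
Local Open Scope ring_scope.

(** On rd-continuous functions the Volterra operator V is monotone and, in the
    norm weighted by exp (- (2 L + 1) (t - a)), a contraction of factor 1/2.
    Hence (x_n) converges geometrically to the unique fixed point, and
    v <= V v and V w <= w give v <= x_n <= w by induction.

    Antiderivatives are suprema of lower sums.  They are compared with each
    other, and with the weight, by induction along the time scale.  That V
    preserves rd-continuity rests on compactness of I_T: near t0, along a side,
    t |-> k(t, s, x(s)) has small oscillation uniformly in s, because every
    point of I_T has a neighbourhood covered by at most two sides. *)

(** * Topology of a time-scale interval *)

Section Filters.
Context {R : realType} {S : Type} {F : set_system S} {FF : Filter F}.

(** Completeness of the reals. The improper filter converges to everything and is split off, so the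
    lemma applies along a side without a proof that the side accumulates at the point. *)
Lemma osc_cvg (g : S -> R) :
  (forall e, 0 < e -> \forall x \near F & y \near F, `|g x - g y| <= e) ->
  exists l : R, g x @[x --> F] --> l.
Proof.
move=> osc; have [F0|F0] := pselect (F set0).
  by exists 0 => A _; exact: (filterS (@sub0set _ _) F0).
have PF : ProperFilter F by split.
have PG : ProperFilter (g x @[x --> F]) by exact: fmap_proper_filter.
apply/cvg_ex/cauchy_cvgP/cauchy_ballP => e e0.
have e2 : 0 < e / 2 by rewrite divr_gt0.
have [[A B] [/= FA FB] AB] := osc _ e2.
exists (g @` A, g @` B) => /=.
  split; [apply: filterS FA|apply: filterS FB] => x Ax; by exists x.
move=> [_ _] [/= [x Ax <-] [y By <-]] /=.
rewrite /ball/=; apply: (le_lt_trans (AB (x, y) (conj Ax By))).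
by rewrite ltr_pdivrMr // ltr_pMr // ltr1n.
Qed.

Lemma cvg_osc (g : S -> R) (l e : R) : g x @[x --> F] --> l -> 0 < e ->
  \forall x \near F & y \near F, `|g x - g y| <= e.
Proof.
move=> /cvgrPdist_le gl e0; have e2 : 0 < e / 2 by rewrite divr_gt0.
have gle := gl _ e2.
exists ([set x | `|l - g x| <= e / 2], [set x | `|l - g x| <= e / 2]) => //.
move=> [x y] [/= hx hy]; rewrite (splitr e).
rewrite (_ : g x - g y = (l - g y) - (l - g x)); last by ring.
by rewrite (le_trans (ler_normB _ _)) // addrC lerD.
Qed.

End Filters.

Section TimeScaleTopology.
Context {R : realType} {T : set R} {a b : R}.
Hypotheses (hT : time_scale T) (ha : T a) (hb : T b) (hab : a < b).
Local Notation IT := (ts_interval T a b).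

Lemma ts_intervalP t : IT t <-> a <= t /\ t <= b /\ T t.
Proof.
rewrite /ts_interval /=; split=> [[]|[h1 [h2 h3]]].
  by rewrite in_itv/= => /andP[].
by split=> //; rewrite in_itv/= h1.
Qed.

Lemma ts_interval_left : IT a.
Proof. by apply/ts_intervalP; rewrite lexx ltW. Qed.

Lemma ts_interval_closed : closed IT.
Proof. by apply: closedI; [exact: itv_closed|case: hT]. Qed.

Lemma ts_interval_compact : compact IT.
Proof.
apply: (subclosed_compact ts_interval_closed (@segment_compact R a b)).
by move=> x [].
Qed.

(** Compactness in the form used below: what holds near each point of the interval and eventually
    along a filter holds eventually along the filter at all points at once. *)
Lemma ts_interval_near_covering : near_covering_within IT.
Proof.
exact/near_covering_withinP/compact_near_coveringP/ts_interval_compact.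
Qed.

Let right_nonempty t : t < b -> [set s | T s /\ t < s] !=set0.
Proof. by move=> tb; exists b. Qed.

Let right_lbound t : has_lbound [set s | T s /\ t < s].
Proof. by exists t => s [_ /ltW]. Qed.

Lemma sigma_ge t : t < b -> t <= sigma T t.
Proof.
by move=> tb; apply: lb_le_inf; [exact: right_nonempty|move=> s [_ /ltW]].
Qed.

Lemma sigma_le t u : T u -> t < u -> sigma T t <= u.
Proof. by move=> Tu tu; apply: ge_inf. Qed.

Lemma sigma_adherent t d : t < b -> 0 < d ->
  exists2 u, T u & t < u < sigma T t + d.
Proof.
move=> tb d0.
have [u [Tu tu] ud] := inf_adherent d0 (conj (right_nonempty _ tb) (right_lbound t)).
by exists u => //; rewrite tu.
Qed.

Lemma sigma_mem t : IT t -> t < b -> IT (sigma T t).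
Proof.
move=> /ts_intervalP[at_ _] tb; apply/ts_intervalP.
have ts := sigma_ge _ tb; split; first exact: le_trans ts.
split; first exact: sigma_le.
apply: (proj2 hT) => B /nbhs_ballP[d /= d0 dB].
have [u Tu /andP[tu us]] := sigma_adherent _ _ tb d0.
exists u; split => //; apply: dB; rewrite /ball/= distrC ger0_norm.
  by rewrite ltrBlDl.
by rewrite subr_ge0 sigma_le.
Qed.

(** Density is defined with the jump operator of [T], the derivative is taken with that of the
    interval. They agree because points of [T] close enough above [sigma T t] stay below [b], unless
    [sigma T t] is [b] itself. *)
Lemma sigma_ts_interval t : IT t -> t < b -> sigma IT t = sigma T t.
Proof.
move=> It tb; have /ts_intervalP[at_ _] := It; apply/le_anti/andP; split.
  have [->|ne] := eqVneq (sigma T t) b.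
    by apply: ge_inf; [exists t => s [_ /ltW]|split=> //; apply/ts_intervalP; rewrite lexx (le_trans at_ (ltW tb))].
  apply/ler_addgt0Pr => e e0.
  have d0 : 0 < Num.min e (b - sigma T t).
    rewrite lt_min e0 subr_gt0 lt_neqAle ne /=.
    by have /ts_intervalP[_ []] := sigma_mem _ It tb.
  have [u Tu /andP[tu us]] := sigma_adherent _ _ tb d0.
  have us1 : u < sigma T t + e.
    by apply: (lt_le_trans us); rewrite lerD2l ge_min lexx.
  have us2 : u < b.
    apply: (lt_le_trans us); rewrite -lerBrDl ge_min lexx orbT//.
  apply: (le_trans _ (ltW us1)); apply: ge_inf; first by exists t => s [_ /ltW].
  by split=> //; apply/ts_intervalP; rewrite (le_trans at_ (ltW tu)) (ltW us2).
apply: lb_le_inf.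
  by exists b; split=> //; apply/ts_intervalP; rewrite lexx (le_trans at_ (ltW tb)).
by move=> s [/ts_intervalP[_ [_ Ts]] ts]; exact: sigma_le.
Qed.

(** At a right-dense point the whole interval is a side. Any other point has no close neighbour on
    its right, which leaves the point itself and, if it is left-dense, the part on its left. *)
Lemma sides_cover s0 : IT s0 -> exists B1 B2,
  [/\ rd_sides T a b s0 B1, rd_sides T a b s0 B2 &
      \forall s \near s0, IT s -> B1 s \/ B2 s].
Proof.
move=> Is0; have /ts_intervalP[as0 [s0b Ts0]] := Is0.
have [rd|nrd] := pselect (right_dense T b s0).
  exists IT, IT; split; try by left.
  by near=> s => Is; left.
(* A point that is not right-dense is the maximum [b] or has a gap on its right. *)
have gapr : \forall s \near s0, IT s -> s <= s0.
  have [s0b'|bs0] := ltP s0 b; last first.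
    by near=> s => /ts_intervalP[_ [sb _]]; exact: le_trans sb bs0.
  have lt : s0 < sigma T s0.
    rewrite lt_neqAle sigma_ge // andbT; apply/eqP => eqs; exact: nrd.
  near=> s => /ts_intervalP[_ [_ Ts]]; rewrite leNgt; apply/negP => s0s.
  have := sigma_le _ _ Ts s0s; apply/negP; rewrite -ltNge.
  near: s; exact: lt_nbhsl.
have [ld|nld] := pselect (left_dense T a s0).
  exists [set s0], (IT `&` [set s | s < s0]); split.
  - by right; split=> //; left.
  - by right; split=> //; right; split.
  apply: filterS gapr => s gs Is; move: (gs Is).
  by rewrite le_eqVlt => /orP[/eqP ->|]; [left|right].
exists [set s0], [set s0]; split; try by right; split=> //; left.
have gapl : \forall s \near s0, IT s -> s0 <= s.
  have [as0'|s0a] := ltP a s0; last first.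
    by near=> s => /ts_intervalP[sa _]; exact: le_trans sa.
  have ub : has_ubound [set s | T s /\ s < s0] by exists s0 => s [_ /ltW].
  have lt : rho T s0 < s0.
    rewrite lt_neqAle; apply/andP; split.
      by apply/eqP => eqs; exact: nld.
    by apply: ge_sup; [exists a|move=> s [_ /ltW]].
  near=> s => /ts_intervalP[_ [_ Ts]]; rewrite leNgt; apply/negP => s0s.
  have : s <= rho T s0 by apply: ub_le_sup.
  apply/negP; rewrite -ltNge.
  near: s; exact: lt_nbhsr.
apply: filterS2 gapl gapr => s gl gr Is; left.
by apply/le_anti; rewrite gl // gr.
Unshelve. all: by end_near. Qed.

Lemma near_sides {J : Type} (F : set_system J) (P : J -> R -> Prop) s0 :
  Filter F -> IT s0 ->
  (forall B, rd_sides T a b s0 B ->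
     \forall s \near s0 & i \near F, B s -> P i s) ->
  \forall s \near s0 & i \near F, IT s -> P i s.
Proof.
move=> FF /sides_cover[B1 [B2 [h1 h2 cov]]] h.
have [[U1 V1] [/= nU1 FV1] UV1] := h _ h1.
have [[U2 V2] [/= nU2 FV2] UV2] := h _ h2.
exists (U1 `&` U2 `&` [set s | IT s -> B1 s \/ B2 s], V1 `&` V2) => /=.
  by split; [apply: filterI => //; exact: filterI|exact: filterI].
move=> [s i] [/= [[U1s U2s] Bs] [V1i V2i]] /Bs[B|B].
  exact: (UV1 (s, i) (conj U1s V1i)).
exact: (UV2 (s, i) (conj U2s V2i)).
Qed.

Lemma side_sub t A : IT t -> rd_sides T a b t A -> A `<=` IT.
Proof.
by move=> It [[_ ->] //|[_ [-> s -> //|[_ ->] s []]]].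
Qed.

Lemma side_mem t : exists2 A, rd_sides T a b t A & IT t -> A t.
Proof.
have [rd|nrd] := pselect (right_dense T b t).
  by exists IT => //; left.
by exists [set t] => //; right; split=> //; left.
Qed.

(** This gives one-variable rd-continuity the form of [rd_continuous3]. At a right-dense point the
    limit along the whole interval contains the left limit; elsewhere the side reduced to the point
    imposes nothing. *)
Lemma rd_continuousP g : rd_continuous T a b g <->
  forall t A, IT t -> rd_sides T a b t A -> exists2 l : R,
    g s @[s --> within A (nbhs t)] --> l & A t -> l = g t.
Proof.
split=> [h t A It|h t It].
  have [hr hl] := h t It; case=> [[rd ->]|[nrd [->|[ld ->]]]].
  - by exists (g t) => //; exact: hr.
  - exists (g t) => //; apply/cvgrPdist_le => e e0.
    near=> s; suff -> : s = t by rewrite subrr normr0 ltW.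
    by near: s; exact: withinT.
  - by have [l hl'] := hl ld; exists l => // -[_ /=]; rewrite ltxx.
have [rd|nrd] := pselect (right_dense T b t); last first.
  split=> // ld; have [|l hl _] := h t (IT `&` [set s | s < t]) It.
    by right; split=> //; right.
  by exists l.
have [|l hl le] := h t IT It; first by left.
rewrite le // in hl; split=> // _; exists (g t) => B nB.
have nB' : \forall s \near t, IT s -> B (g s) := hl _ nB.
suff : \forall s \near t, (IT `&` [set s | s < t]) s -> B (g s) by [].
by apply: filterS nB' => s sB [/sB].
Unshelve. all: by end_near. Qed.

(** The bound is the parameter of the covering argument, along the filter [+oo]: near a point
    [|l| + 1] works along each side with limit [l], and compactness yields a common bound. *)
Lemma rd_bounded g : rd_continuous T a b g ->
  exists2 M : R, 0 <= M & forall t, IT t -> `|g t| <= M.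
Proof.
move/rd_continuousP => rg.
have : \forall M \near +oo, IT `<=` [set s | `|g s| <= M].
  apply: ts_interval_near_covering => s0 Is0; apply: near_sides => // B sB.
  have [l gl _] := rg _ _ Is0 sB; move/cvgrPdist_le : gl => /(_ 1 ltr01) gl.
  exists ([set s | B s -> `|l - g s| <= 1], [set M | `|l| + 1 <= M]) => /=.
    by split=> //; exact: nbhs_pinfty_ge.
  move=> [s M] [/= hs hM] /hs {}hs; apply: le_trans hM.
  rewrite (_ : g s = l - (l - g s)); last by ring.
  by rewrite (le_trans (ler_normB _ _)) // lerD2l.
move=> [M [_ hM]]; exists (Num.max (M + 1) 0); first by rewrite le_max lexx orbT.
by move=> t It; apply: hM => //; rewrite lt_max ltrDl ltr01.
Qed.

End TimeScaleTopology.

(** * Antiderivatives and the delta integral *)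

Section Antiderivative.
Context {R : realType} {T : set R} {a b : R}.
Hypotheses (hT : time_scale T) (ha : T a) (hb : T b) (hab : a < b).
Local Notation IT := (ts_interval T a b).

(** * Lower Darboux integrals on the time scale *)

Section LowerIntegral.
Variable g : R -> R.

(* [lower_sum s y]: y is a lower Darboux sum of g over some partition of
   [a, s[ by points of the time scale. *)
Inductive lower_sum : R -> R -> Prop :=
| lower_sum0 : lower_sum a 0
| lower_sumS r y m s : lower_sum r y -> IT s -> r <= s ->
    (forall u, IT u -> r <= u -> u < s -> m <= g u) ->
    lower_sum s (y + m * (s - r)).

Definition lower_integral t := sup [set y | lower_sum t y].

Lemma lower_sum_mem s y : lower_sum s y -> IT s.
Proof. by case=> // ; exact: ts_interval_left. Qed.

Variable M : R.
Hypotheses (gM : forall t, IT t -> `|g t| <= M).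

Let gNM t : IT t -> - M <= g t.
Proof. by move=> /gM; rewrite ler_norml => /andP[]. Qed.

Let gPM t : IT t -> g t <= M.
Proof. by move=> /gM; rewrite ler_norml => /andP[]. Qed.

Lemma lower_sum_le s y : lower_sum s y -> y <= M * (s - a).
Proof.
elim=> [|r {}y m {}s ly IH Is rs h]; first by rewrite subrr mulr0.
have Ir := lower_sum_mem _ _ ly.
have : m * (s - r) <= M * (s - r).
  (* An empty block does not constrain [m], but its term vanishes; otherwise the left end [r] gives
     [m <= g r <= M]. *)
  move: rs; rewrite le_eqVlt => /orP[/eqP ->|rs]; first by rewrite subrr !mulr0.
  by rewrite ler_wpM2r ?subr_ge0 ?(ltW rs) // (le_trans (h r _ _ _)) // gPM.
lra.
Qed.

Lemma lower_sum_has_sup t : IT t -> has_sup [set y | lower_sum t y].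
Proof.
move=> It; split; last by exists (M * (t - a)) => y /lower_sum_le.
have /ts_intervalP[at_ _] := It.
exists (0 + - M * (t - a)); apply: lower_sumS => //; first exact: lower_sum0.
by move=> u Iu _ _; exact: gNM.
Qed.

(** A lower sum up to [t] extends by one block to a lower sum up to [s]. This bound and
    [lower_integral_le] carry everything that follows about the supremum. *)
Lemma lower_integral_ge t s m : IT t -> IT s -> t <= s ->
  (forall u, IT u -> t <= u -> u < s -> m <= g u) ->
  m * (s - t) <= lower_integral s - lower_integral t.
Proof.
move=> It Is ts h; rewrite lerBrDl -lerBrDr.
apply: ge_sup; first by case: (lower_sum_has_sup _ It).
move=> y ly; rewrite lerBrDr.
apply: (sup_upper_bound (lower_sum_has_sup _ Is)); exact: lower_sumS.
Qed.

(** Induction on the partition. A block beyond [t] contributes at most [C] times its length; the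
    block that contains [t] is split there, and its left half completes a lower sum up to [t]. *)
Lemma lower_sum_cut t s y C : lower_sum s y -> IT t -> t <= s ->
  (forall u, IT u -> t <= u -> u < s -> g u <= C) ->
  y <= lower_integral t + C * (s - t).
Proof.
move=> ly It; elim: ly => [|r {}y m {}s ly IH Is rs h] ts hC.
  have /ts_intervalP[at_ _] := It.
  rewrite (_ : t = a) ?subrr ?mulr0 ?addr0; last by apply/le_anti; rewrite ts.
  apply: (sup_upper_bound (lower_sum_has_sup _ (ts_interval_left ha hab))).
  exact: lower_sum0.
have Ir := lower_sum_mem _ _ ly.
have [tr|rt] := leP t r.
  have : m * (s - r) <= C * (s - r).
    move: rs; rewrite le_eqVlt => /orP[/eqP ->|rs]; first by rewrite subrr !mulr0.
    by rewrite ler_wpM2r ?subr_ge0 ?(ltW rs) // (le_trans (h r _ _ _)) // hC.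
  have := IH tr (fun u Iu tu ur => hC u Iu tu (lt_le_trans ur rs)).
  lra.
have : m * (s - t) <= C * (s - t).
  move: ts; rewrite le_eqVlt => /orP[/eqP ->|ts]; first by rewrite subrr !mulr0.
  by rewrite ler_wpM2r ?subr_ge0 ?(ltW ts) // (le_trans (h t _ (ltW rt) _)) // hC.
have : y + m * (t - r) <= lower_integral t.
  apply: (sup_upper_bound (lower_sum_has_sup _ It)).
  apply: lower_sumS => //; first exact: ltW.
  by move=> u Iu ru ut; apply: h => //; exact: lt_le_trans ts.
lra.
Qed.

Lemma lower_integral_le t s C : IT t -> IT s -> t <= s ->
  (forall u, IT u -> t <= u -> u < s -> g u <= C) ->
  lower_integral s - lower_integral t <= C * (s - t).
Proof.
move=> It Is ts h; rewrite lerBlDl.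
apply: ge_sup; first by case: (lower_sum_has_sup _ Is).
by move=> y ly; exact: lower_sum_cut.
Qed.

Lemma lower_integral_lip t s : IT t -> IT s ->
  `|lower_integral t - lower_integral s| <= M * `|t - s|.
Proof.
wlog ts : t s / t <= s.
  by move=> h It Is; have [/h|/ltW/h] := leP t s; [|rewrite distrC (distrC t)]; apply.
move=> It Is; rewrite distrC (distrC t) (ger0_norm (_ : 0 <= s - t)) ?subr_ge0 //.
rewrite ler_norml -mulNr lower_integral_ge ?lower_integral_le //.
  by move=> u Iu _ _; exact: gPM.
by move=> u Iu _ _; exact: gNM.
Qed.

(** Points between [t] and [s] are no farther from [t] than [s], so [g] stays within [e] of [g t] on
    the whole block and both increment bounds apply. *)
Lemma lower_integral_dense t (e : R) : IT t -> 0 < e ->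
  g s @[s --> within IT (nbhs t)] --> g t ->
  \forall s \near t, IT s ->
    `|lower_integral t - lower_integral s - g t * (t - s)| <= e * `|t - s|.
Proof.
move=> It e0 /cvgrPdist_le /(_ _ e0) gt.
have {gt} : \forall s \near t, IT s -> `|g t - g s| <= e by [].
move=> /nbhs_ballP[d /= d0 dB]; apply/nbhs_ballP; exists d => //= s ts Is.
have gb u : IT u -> `|t - u| < d -> g t - e <= g u <= g t + e.
  move=> Iu tu; have := dB u tu Iu; rewrite ler_norml => /andP[h1 h2].
  by apply/andP; split; lra.
have [st|st] := leP s t.
  have lo u : IT u -> s <= u -> u < t -> g t - e <= g u <= g t + e.
    move=> Iu su ut; apply: gb => //; apply: le_lt_trans ts.
    by rewrite !ger0_norm ?subr_ge0 ?(ltW ut) // lerD2l lerN2.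
  have L := lower_integral_ge s t (g t - e) Is It st.
  have U := lower_integral_le s t (g t + e) Is It st.
  have {}L := L (fun u h1 h2 h3 => proj1 (andP (lo u h1 h2 h3))).
  have {}U := U (fun u h1 h2 h3 => proj2 (andP (lo u h1 h2 h3))).
  by rewrite [`|t - s|]ger0_norm ?subr_ge0 // ler_norml; apply/andP; split; lra.
have lo u : IT u -> t <= u -> u < s -> g t - e <= g u <= g t + e.
  move=> Iu tu us; apply: gb => //; apply: le_lt_trans ts.
  rewrite distrC (distrC t) !ger0_norm ?subr_ge0 ?(ltW st) //.
  by rewrite lerD2r (ltW us).
have L := lower_integral_ge t s (g t - e) It Is (ltW st).
have U := lower_integral_le t s (g t + e) It Is (ltW st).
have {}L := L (fun u h1 h2 h3 => proj1 (andP (lo u h1 h2 h3))).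
have {}U := U (fun u h1 h2 h3 => proj2 (andP (lo u h1 h2 h3))).
rewrite [`|t - s|]distrC [`|s - t|]ger0_norm ?subr_ge0 ?(ltW st) // ler_norml.
by apply/andP; split; lra.
Qed.

End LowerIntegral.

(** The lower integral serves. At a right-dense point [g] is continuous; at a right-scattered one
    the increment up to [sigma T t] is exact, as [t] is the only point before the jump, and the
    Lipschitz bound handles nearby [s]. *)
Lemma antiderivative_exists g : rd_continuous T a b g ->
  exists F, delta_antiderivative T a b g F.
Proof.
move=> rg; have [M M0 gM] := rd_bounded hT ha hb _ rg.
exists (lower_integral g); split.
  apply/subspace_continuousP => t It; apply/cvgrPdist_le => e e0.
  suff : \forall s \near t, IT s ->
    `|lower_integral g t - lower_integral g s| <= e by [].
  apply/nbhs_ballP; have M1 : 0 < M + 1 by rewrite ltr_wpDl.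
  exists (e / (M + 1)) => /=; first by rewrite divr_gt0.
  move=> s; rewrite /ball/= ltr_pdivlMr // => ts Is.
  apply: (le_trans (lower_integral_lip _ M gM _ _ It Is)).
  by apply: le_trans (ltW ts); rewrite mulrC ler_wpM2l // lerDl.
move=> t It tb e e0; rewrite (sigma_ts_interval hT hb _ It tb).
have st := sigma_ge hb _ tb.
suff : \forall s \near t, IT s ->
  `|lower_integral g (sigma T t) - lower_integral g s - g t * (sigma T t - s)|
    <= e * `|sigma T t - s| by [].
move: st; rewrite le_eqVlt => /orP[/eqP st|st].
  rewrite -st; apply: (lower_integral_dense _ M) => //.
  by have [+ _] := rg t It; apply; split.
have Is := sigma_mem hT hb _ It tb.
have gap u : IT u -> t <= u -> u < sigma T t -> u = t.
  move=> /ts_intervalP[_ [_ Tu]]; rewrite le_eqVlt => /orP[/eqP -> //|tu].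
  by rewrite ltNge (sigma_le _ _ Tu tu).
have Fs : lower_integral g (sigma T t) - lower_integral g t = g t * (sigma T t - t).
  apply/le_anti/andP; split.
    by apply: (lower_integral_le _ M) => // [|u Iu tu /(gap _ Iu tu) ->//]; exact: ltW.
  by apply: (lower_integral_ge _ M) => // [|u Iu tu /(gap _ Iu tu) ->//]; exact: ltW.
have K0 : 0 < M + M + 1 by rewrite ltr_wpDl // addr_ge0.
have h0 : 0 < (sigma T t - t) / 2 by rewrite divr_gt0 ?subr_gt0.
have d0 : 0 < e * ((sigma T t - t) / 2) by rewrite mulr_gt0.
(* The first radius keeps [sigma T t - s] above half the gap; the second keeps the error, at most
   [(M + M) * |t - s|], below [e] times half the gap. *)
apply/nbhs_ballP; exists (Num.min ((sigma T t - t) / 2) (e * ((sigma T t - t) / 2) / (M + M + 1))) => /=.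
  by rewrite lt_min h0 divr_gt0.
move=> s; rewrite /ball/= lt_min => /andP[ts1]; rewrite ltr_pdivlMr // => ts2 Iss.
rewrite (_ : _ - _ - _ = (lower_integral g t - lower_integral g s) - g t * (t - s)); last first.
  rewrite -[lower_integral g (sigma T t)](subrK (lower_integral g t)) Fs; ring.
apply: (@le_trans _ _ (e * ((sigma T t - t) / 2))).
  apply: le_trans (ltW ts2); rewrite (le_trans (ler_normB _ _)) //.
  have := lower_integral_lip _ M gM _ _ It Iss.
  rewrite normrM; have : `|g t| * `|t - s| <= M * `|t - s| by rewrite ler_wpM2r ?gM.
  have := normr_ge0 (t - s); lra.
rewrite ler_wpM2l ?(ltW e0) //.
apply: (le_trans _ (ler_norm _)).
have : t - s >= - ((sigma T t - t) / 2) by move: (ltW ts1); rewrite ler_norml => /andP[].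
lra.
Qed.

(** The supremum of the points up to [s] where [P] holds is in the closed interval and satisfies [P]
    by the limit clause; were it below [s], the step would pass it. A single further point suffices
    in the step, whether the point is right-dense or right-scattered. *)
Lemma ts_induction r s (P : R -> Prop) : IT r -> IT s -> r <= s -> P r ->
  (forall t, IT t -> r <= t -> t < s -> P t ->
     exists u, [/\ IT u, t < u, u <= s & P u]) ->
  (forall t, IT t -> r <= t -> t <= s ->
     (forall e, 0 < e -> exists u, [/\ IT u, r <= u, t - e < u, u <= t & P u]) ->
     P t) ->
  P s.
Proof.
move=> Ir Is rs Pr step lim.
pose A := [set t | [/\ IT t, r <= t, t <= s & P t]].
have hA : has_sup A by split; [exists r|exists s => t []].
have As : sup A <= s by apply: ge_sup; [exists r|move=> t []].
have rA : r <= sup A by apply: (sup_upper_bound hA).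
have adh e : 0 < e -> exists u, [/\ IT u, r <= u, sup A - e < u, u <= sup A & P u].
  move=> e0; have [u Au eu] := sup_adherent e0 hA; exists u.
  by case: (Au) => *; split=> //; apply: (sup_upper_bound hA).
have IA : IT (sup A).
  apply: (ts_interval_closed hT) => B /nbhs_ballP[d /= d0 dB].
  have [u [Iu ru du uA Pu]] := adh _ d0; exists u; split=> //; apply: dB.
  by rewrite /ball/= ger0_norm ?subr_ge0 // ltrBlDr -ltrBlDl.
have PA := lim _ IA rA As adh.
move: As; rewrite le_eqVlt => /orP[/eqP <- //|As].
have [u [Iu tu us Pu]] := step _ IA rA As PA.
have : u <= sup A by apply: (sup_upper_bound hA); split=> //; rewrite (le_trans rA) ?ltW.
by rewrite leNgt tu.
Qed.

Lemma within_continuous_left (F : R -> R) t e :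
  {within IT, continuous F} -> IT t -> 0 < e ->
  exists2 d, 0 < d & forall u, IT u -> t - d < u -> u <= t -> `|F t - F u| <= e.
Proof.
move=> /subspace_continuousP cF It e0.
have : \forall s \near t, IT s -> `|F t - F s| <= e.
  by have /cvgrPdist_le/(_ _ e0) := cF _ It.
move=> /nbhs_ballP[d /= d0 dB]; exists d => // u Iu tu ut; apply: dB => //.
by rewrite /ball/= ger0_norm ?subr_ge0 // ltrBlDr -ltrBlDl.
Qed.

(** A first-order expansion to the right that treats dense and scattered points alike, for the step
    of [ts_induction]. *)
Lemma antiderivative_right g F t e : delta_antiderivative T a b g F ->
  IT t -> t < b -> 0 < e ->
  exists2 d, 0 < d & forall u, IT u -> t < u -> u < t + d \/ u = sigma T t ->
    `|F u - F t - g t * (u - t)| <= e * (u - t).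
Proof.
move=> [_ dF] It tb e0.
have := dF _ It tb _ e0; rewrite (sigma_ts_interval hT hb _ It tb) => h.
have {}h : \forall s \near t, IT s ->
  `|F (sigma T t) - F s - g t * (sigma T t - s)| <= e * `|sigma T t - s| by [].
have := sigma_ge hb _ tb; rewrite le_eqVlt => /orP[/eqP st|st].
  move: h; rewrite -st => /nbhs_ballP[d /= d0 dB]; exists d => // u Iu tu [ud|ut].
    have tud : ball t d u by rewrite /ball/= distrC gtr0_norm ?subr_gt0 // ltrBlDl.
    have := dB u tud Iu; rewrite [`|t - u|]distrC [`|u - t|]gtr0_norm ?subr_gt0 //.
    rewrite -[X in X <= _ -> _]normrN.
    by rewrite (_ : - (F t - F u - _) = F u - F t - g t * (u - t)); last by ring.
  by move: tu; rewrite ut ltxx.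
(* With this radius no point beyond [t] satisfies [u < t + d], so only [u = sigma T t] remains. *)
exists (sigma T t - t); first by rewrite subr_gt0.
move=> u Iu tu [ud|->].
  have /ts_intervalP[_ [_ Tu]] := Iu; have := sigma_le _ _ Tu tu.
  by rewrite leNgt; move: ud; rewrite addrC subrK => ->.
(* The estimate defining the derivative, read at [s = t]. *)
have Fe d : 0 < d ->
    `|F (sigma T t) - F t - g t * (sigma T t - t)| <= d * `|sigma T t - t|.
  move=> d0; have := dF _ It tb _ d0; rewrite (sigma_ts_interval hT hb _ It tb).
  move=> /nbhs_singleton; exact.
by have := Fe _ e0; rewrite [`|sigma T t - t|]gtr0_norm ?subr_gt0.
Qed.

Lemma right_point t s d : IT t -> IT s -> t < s -> 0 < d ->
  exists u, [/\ IT u, t < u, u <= s & u < t + d \/ u = sigma T t].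
Proof.
move=> It Is ts d0; have /ts_intervalP[_ [sb Ts]] := Is.
have tb := lt_le_trans ts sb.
have := sigma_ge hb _ tb; rewrite le_eqVlt => /orP[/eqP st|st]; last first.
  exists (sigma T t); split=> //; [exact: sigma_mem|exact: sigma_le|by right].
have d1 : 0 < Num.min d (s - t) by rewrite lt_min d0 subr_gt0.
have [u Tu /andP[tu]] := sigma_adherent hb t _ tb d1.
rewrite -st -ltrBlDl lt_min !ltrBlDl [t + (s - t)]addrC subrK => /andP[ud us].
exists u; split=> //; [|exact: ltW|by left].
apply/ts_intervalP; split; last by rewrite (le_trans (ltW us)).
by have /ts_intervalP[at_ _] := It; rewrite (le_trans at_) ?ltW.
Qed.

(** [H] majorizes the integral of [g - h]. Taking [H] zero gives monotonicity and uniqueness, [H]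
    linear gives norm bounds, and [H] exponential gives the weighted contraction. *)
Lemma antiderivative_cmp g h F G H :
  delta_antiderivative T a b g F -> delta_antiderivative T a b h G ->
  {within IT, continuous H} ->
  (forall t u, IT t -> IT u -> t < u -> (g t - h t) * (u - t) <= H u - H t) ->
  forall r s, IT r -> IT s -> r <= s -> F s - F r <= G s - G r + (H s - H r).
Proof.
move=> aF aG cH gh r s Ir Is rs.
(* The slack [e * (s - r)] pays for the first-order errors in the induction, [e / 2] for each of [F]
   and [G], and is removed by letting [e] tend to 0. *)
suff key e : 0 < e ->
    F s - F r <= G s - G r + (H s - H r) + e * (s - r).
  apply/ler_addgt0Pr => e e0.
  have sr : 0 < s - r + 1 by rewrite ltr_wpDl // subr_ge0.
  have /key : 0 < e / (s - r + 1) by rewrite divr_gt0.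
  move=> /le_trans; apply; rewrite lerD2l mulrAC ler_pdivrMr // ler_pM2l //.
  by rewrite lerDl.
move=> e0; move: s Is rs => s0 Is0 rs0.
apply: (ts_induction r s0 (fun s => F s - F r <= G s - G r + (H s - H r) + e * (s - r))) => //.
- by rewrite !subrr mulr0 !addr0.
- move=> t It rt ts IHt; have e2 : 0 < e / 2 by rewrite divr_gt0.
  have tb : t < b by apply: (lt_le_trans ts); have /ts_intervalP[_ []] := Is0.
  have [d1 d10 hF] := antiderivative_right _ _ _ _ aF It tb e2.
  have [d2 d20 hG] := antiderivative_right _ _ _ _ aG It tb e2.
  have d0 : 0 < Num.min d1 d2 by rewrite lt_min d10.
  have [u [Iu tu us ud]] := right_point _ _ _ It Is0 ts d0.
  exists u; split=> //; have := gh _ _ It Iu tu.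
  have : u < t + d1 \/ u = sigma T t.
    by case: ud => [|->]; [rewrite -ltrBlDl lt_min ltrBlDl => /andP[]; left|right].
  have : u < t + d2 \/ u = sigma T t.
    by case: ud => [|->]; [rewrite -ltrBlDl lt_min !ltrBlDl => /andP[]; left|right].
  move=> /(hG _ Iu tu); rewrite ler_norml => /andP[h1 h2].
  move=> /(hF _ Iu tu); rewrite ler_norml => /andP[h3 h4].
  by move: IHt; lra.
move=> t It rt ts IHt; apply/ler_addgt0Pr => d d0.
(* Limit clause: the values of [F], [G] and [H] are moved from [u] to [t], each at a cost of
   [d / 4]. *)
have d4 : 0 < d / 4 by rewrite divr_gt0.
have [d1 d10 hF] := within_continuous_left _ _ _ aF.1 It d4.
have [d2 d20 hG] := within_continuous_left _ _ _ aG.1 It d4.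
have [d3 d30 hH] := within_continuous_left _ _ _ cH It d4.
have dm : 0 < Num.min d1 (Num.min d2 d3) by rewrite !lt_min d10 d20.
have [u [Iu ru tu ut Pu]] := IHt _ dm.
move: tu; rewrite ltrBlDr -ltrBlDl !lt_min => /and3P[h1 h2 h3].
have := hF u Iu; rewrite ltrBlDr -ltrBlDl => /(_ h1 ut); rewrite ler_norml => /andP[_ k1].
have := hG u Iu; rewrite ltrBlDr -ltrBlDl => /(_ h2 ut); rewrite ler_norml => /andP[k2 _].
have := hH u Iu; rewrite ltrBlDr -ltrBlDl => /(_ h3 ut); rewrite ler_norml => /andP[k3 _].
have : e * (u - r) <= e * (t - r) by rewrite ler_pM2l // lerD2r.
by move: Pu; lra.
Qed.

Lemma antiderivative_unique g F G :
  delta_antiderivative T a b g F -> delta_antiderivative T a b g G ->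
  forall r s, IT r -> IT s -> F s - F r = G s - G r.
Proof.
move=> aF aG.
have main r s : IT r -> IT s -> r <= s -> F s - F r = G s - G r.
  move=> Ir Is rs; apply/le_anti/andP; split.
    rewrite -[leRHS]addr0 -(subrr 0).
    apply: (antiderivative_cmp _ _ _ _ (cst 0) aF aG) => //.
      by move=> ?; exact: cvg_cst.
    by move=> t u It Iu tu; rewrite !subrr mul0r.
  rewrite -[leRHS]addr0 -(subrr 0).
  apply: (antiderivative_cmp _ _ _ _ (cst 0) aG aF) => //.
    by move=> ?; exact: cvg_cst.
  by move=> t u It Iu tu; rewrite !subrr mul0r.
move=> r s Ir Is; have [rs|/ltW sr] := leP r s; first exact: main.
have := main _ _ Is Ir sr; lra.
Qed.

(** The existence of [F] rules out the default of [xget], and uniqueness makes the chosen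
    antiderivative irrelevant. *)
Lemma delta_integralE g F r s : delta_antiderivative T a b g F ->
  IT r -> IT s -> delta_integral T a b g r s = F s - F r.
Proof.
move=> aF Ir Is; rewrite /delta_integral; case: xgetP => [_ _ [G aG <-]|/(_ (F s - F r))].
  exact: antiderivative_unique aG aF r s Ir Is.
by case; exists F.
Qed.

End Antiderivative.

(** * The Volterra operator *)

Section RdFunctions.
Context {R : realType} {T : set R} {a b : R}.
Hypotheses (hT : time_scale T) (ha : T a) (hb : T b) (hab : a < b).
Local Notation IT := (ts_interval T a b).

Lemma rd_continuous_oscP g : rd_continuous T a b g <->
  forall t A e, IT t -> rd_sides T a b t A -> 0 < e ->
    \forall x \near within A (nbhs t) & y \near within A (nbhs t),
      `|g x - g y| <= e.
Proof.
split=> [/rd_continuousP rg t A e It sA e0|h].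
  by have [l gl _] := rg _ _ It sA; exact: cvg_osc gl e0.
apply/rd_continuousP => t A It sA.
have [At|nAt] := pselect (A t); last first.
  by have [|l gl] := @osc_cvg R _ (within A (nbhs t)) _ g; [move=> e; exact: h|exists l].
(* Since [t] lies on the side, it can be one of the two points compared, which makes [g t] the
   limit. *)
exists (g t) => //; apply/cvgrPdist_le => e e0.
have [[U V] [/= nU nV] UV] := h _ _ _ It sA e0.
suff : within A (nbhs t) (fun s => `|g t - g s| <= e) by [].
apply: filterS nV => s Vs; apply: (UV (t, s)); split=> //=.
exact: (nbhs_singleton nU).
Qed.

Lemma rd_uniform_limit (u : nat -> R -> R) g : (forall n, rd_continuous T a b (u n)) ->
  (forall e, 0 < e -> exists n, forall t, IT t -> `|g t - u n t| <= e) ->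
  rd_continuous T a b g.
Proof.
move=> ru ug; apply/rd_continuous_oscP => t A e It sA e0.
have e3 : 0 < e / 3 by rewrite divr_gt0.
have [n un] := ug _ e3.
have /rd_continuous_oscP/(_ _ _ _ It sA e3) [[U V] [/= nU nV] UV] := ru n.
exists (U `&` A, V `&` A) => /=; first by split; apply: filterI => //; exact: withinT.
move=> [x y] [/= [Ux Ax] [Vy Ay]].
have := UV (x, y) (conj Ux Vy); rewrite /= ler_norml => /andP[h1 h2].
have := un _ (side_sub _ _ It sA _ Ax); rewrite ler_norml => /andP[h3 h4].
have := un _ (side_sub _ _ It sA _ Ay); rewrite ler_norml => /andP[h5 h6].
by rewrite ler_norml; apply/andP; split; lra.
Qed.

(** A constant sequence in [rd_uniform_limit]. *)
Lemma eq_rd_continuous g h : (forall t, IT t -> h t = g t) ->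
  rd_continuous T a b g -> rd_continuous T a b h.
Proof.
move=> hg rg; apply: (rd_uniform_limit (fun=> g)) => // e e0.
by exists 0%N => t It; rewrite hg // subrr normr0 ltW.
Qed.

Lemma rd_continuous_cst (c : R) : rd_continuous T a b (cst c).
Proof.
by move=> t It; split=> [_|_]; [exact: cvg_cst|exists c; exact: cvg_cst].
Qed.

Lemma delta_integral_cmp g h H r s :
  rd_continuous T a b g -> rd_continuous T a b h -> continuous H ->
  (forall t u, IT t -> IT u -> t < u -> (g t - h t) * (u - t) <= H u - H t) ->
  IT r -> IT s -> r <= s ->
  delta_integral T a b g r s <= delta_integral T a b h r s + (H s - H r).
Proof.
move=> rg rh cH gh Ir Is rs.
have [F aF] := antiderivative_exists hT ha hb hab _ rg.
have [G aG] := antiderivative_exists hT ha hb hab _ rh.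
rewrite (delta_integralE hT hb _ _ _ _ aF Ir Is) (delta_integralE hT hb _ _ _ _ aG Ir Is).
apply: (antiderivative_cmp hT hb _ _ _ _ _ aF aG) => //.
exact: continuous_subspaceT.
Qed.

Lemma delta_integral_dist g h H r s :
  rd_continuous T a b g -> rd_continuous T a b h -> continuous H ->
  (forall t u, IT t -> IT u -> t < u -> `|g t - h t| * (u - t) <= H u - H t) ->
  IT r -> IT s -> r <= s ->
  `|delta_integral T a b g r s - delta_integral T a b h r s| <= H s - H r.
Proof.
move=> rg rh cH gh Ir Is rs.
have := delta_integral_cmp _ _ H r s rg rh cH.
have := delta_integral_cmp _ _ H r s rh rg cH.
rewrite ler_norml => h1 h2; apply/andP; split.
  rewrite lerBrDl -lerBrDr opprK; apply: h1 => // t u It Iu tu.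
  apply: le_trans (gh _ _ It Iu tu); rewrite distrC ler_wpM2r ?subr_ge0 ?(ltW tu) //.
  exact: ler_norm.
rewrite lerBlDl; apply: h2 => // t u It Iu tu.
apply: le_trans (gh _ _ It Iu tu); rewrite ler_wpM2r ?subr_ge0 ?(ltW tu) //.
exact: ler_norm.
Qed.

Lemma delta_integral_mono g h r s :
  rd_continuous T a b g -> rd_continuous T a b h ->
  (forall t, IT t -> g t <= h t) -> IT r -> IT s -> r <= s ->
  delta_integral T a b g r s <= delta_integral T a b h r s.
Proof.
move=> rg rh gh Ir Is rs.
have := delta_integral_cmp _ _ (cst 0) r s rg rh.
rewrite subrr addr0; apply=> // [|t u It Iu tu].
  by move=> ?; exact: cvg_cst.
by rewrite mulr_le0_ge0 ?subr_le0 ?gh // subr_ge0 ltW.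
Qed.

Lemma delta_integral_diff g r s t : rd_continuous T a b g ->
  IT r -> IT s -> IT t ->
  delta_integral T a b g r t - delta_integral T a b g r s =
  delta_integral T a b g s t.
Proof.
move=> rg Ir Is It.
have [F aF] := antiderivative_exists hT ha hb hab _ rg.
rewrite !(delta_integralE hT hb _ _ _ _ aF) //; ring.
Qed.

(** Comparison with the zero function, with [H u = M * u]. *)
Lemma delta_integral_norm_le g M r s : rd_continuous T a b g ->
  (forall t, IT t -> `|g t| <= M) -> IT r -> IT s ->
  `|delta_integral T a b g r s| <= M * `|s - r|.
Proof.
move=> rg gM.
wlog rs : r s / r <= s.
  move=> h Ir Is; have [/h|/ltW/h] := leP r s; first by apply.
  rewrite distrC => /(_ Is Ir).
  have := delta_integral_diff _ _ _ _ rg Ir Is Ir.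
  have -> : delta_integral T a b g r r = 0.
    by rewrite -(delta_integral_diff _ _ _ _ rg Ir Ir Ir) subrr.
  by rewrite sub0r => <-; rewrite normrN.
move=> Ir Is; rewrite (ger0_norm (_ : 0 <= s - r)) ?subr_ge0 //.
have a0 : delta_antiderivative T a b (cst 0) (cst 0).
  split; first by apply: continuous_subspaceT => ?; exact: cvg_cst.
  move=> t It tb e e0; near=> u.
  by rewrite /cst/= mul0r !subrr normr0 mulr_ge0 // ltW.
have := delta_integral_dist _ _ (fun u => M * u) r s rg (rd_continuous_cst 0).
rewrite (delta_integralE hT hb _ _ _ _ a0) // subrr subr0 -mulrBr; apply=> //.
  by move=> u; apply: cvgM; [exact: cvg_cst|exact: cvg_id].
by move=> t u It Iu tu; rewrite subr0 -mulrBr ler_wpM2r ?gM // subr_ge0 ltW.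
Unshelve. all: by end_near. Qed.

End RdFunctions.

(** * Kernels composed with rd-continuous functions, and the contraction estimate *)

Section Volterra.
Context {R : realType} {T : set R} {a b : R}.
Hypotheses (hT : time_scale T) (ha : T a) (hb : T b) (hab : a < b).
Local Notation IT := (ts_interval T a b).
Variable k : R -> R -> R -> R.
Hypothesis hk : rd_continuous3 T a b k.

(** The limit of [k] is taken at the limit [p] of [x] along [B], which may differ from [x s0] when
    [s0] is not in [B]; hence the guarded last clause. *)
Lemma kernel_side_limit x t0 s0 A B : rd_continuous T a b x -> IT t0 -> IT s0 ->
  rd_sides T a b t0 A -> rd_sides T a b s0 B ->
  exists2 l : R,
    forall e, 0 < e -> \forall s \near s0 & t \near within A (nbhs t0),
      B s -> `|l - k t s (x s)| <= e &
    A t0 -> B s0 -> l = k t0 s0 (x s0).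
Proof.
move=> /rd_continuousP rx It Is sA sB.
have [p xp xe] := rx _ _ Is sB.
have [l kl ke] := hk _ _ p It Is _ _ sA sB.
exists l; last by move=> At Bs; rewrite -xe //; exact: ke.
move=> e e0; move: kl => /cvgrPdist_le/(_ _ e0) kl.
have {kl} [[W O] [/= [[U V] [/= nU nV] UV] nO] WO] :
  nbhs (t0, s0, p) (fun z => (A `*` B `*` [set: R]) z -> `|l - k z.1.1 z.1.2 z.2| <= e) := kl.
have nxO : \forall s \near s0, B s -> O (x s) := xp _ nO.
exists ([set s | V s /\ (B s -> O (x s))], U `&` A) => /=.
  by split; [exact: filterI|apply: filterI; [exact: cvg_within nU|exact: withinT]].
move=> [s t] [/= [Vs BO] [Ut At]] Bs.
by apply: (WO (t, s, x s)) => //=; split=> //=; [exact: (UV (t, s))|exact: BO].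
Qed.

(** A side of [t] containing [t] is chosen, and the joint limit is restricted to this value of the
    first argument. *)
Lemma kernel_section_rd x t : rd_continuous T a b x -> IT t ->
  rd_continuous T a b (fun s => k t s (x s)).
Proof.
move=> rx It; apply/rd_continuousP => s B Is sB.
have [A sA At] := @side_mem R T a b t.
have [l kl ke] := kernel_side_limit _ _ _ _ _ rx It Is sA sB.
exists l; last by move=> Bs; apply: ke => //; exact: At.
apply/cvgrPdist_le => e e0; have [[V U] [/= nV nU] VU] := kl _ e0.
suff : \forall s' \near s, B s' -> `|l - k t s' (x s')| <= e by [].
apply: filterS nV => s' Vs'.
by apply: (VU (s', t)); split=> //=; apply: (nbhs_singleton nU); exact: At.
Qed.

(** The covering argument runs over [s], with the pair [(t, t')] as parameter; near each [s0] both
    values are within [e / 2] of the same side limit. *)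
Lemma kernel_equi_osc x t0 A e : rd_continuous T a b x -> IT t0 ->
  rd_sides T a b t0 A -> 0 < e ->
  \forall t \near within A (nbhs t0) & t' \near within A (nbhs t0),
    forall s, IT s -> `|k t s (x s) - k t' s (x s)| <= e.
Proof.
move=> rx It sA e0; have e2 : 0 < e / 2 by rewrite divr_gt0.
have := ts_interval_near_covering hT (a := a) (b := b) _
  (filter_prod (within A (nbhs t0)) (within A (nbhs t0)))
  (fun i s => `|k i.1 s (x s) - k i.2 s (x s)| <= e) _.
apply=> s0 Is; apply: (near_sides ha hb) => // B sB.
have [l kl _] := kernel_side_limit _ _ _ _ _ rx It Is sA sB.
have [[V U] [/= nV nU] VU] := kl _ e2.
exists (V, U `*` U) => /=; first by split=> //; exists (U, U).
move=> [s [t t']] [/= Vs [/= Ut Ut']] Bs.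
have := VU (s, t) (conj Vs Ut) Bs; have := VU (s, t') (conj Vs Ut') Bs.
rewrite /= !ler_norml => /andP[h1 h2] /andP[h3 h4].
by apply/andP; split; lra.
Qed.

Lemma kernel_bounded x t0 A : rd_continuous T a b x -> IT t0 ->
  rd_sides T a b t0 A ->
  exists M, \forall t \near within A (nbhs t0),
    forall s, IT s -> `|k t s (x s)| <= M.
Proof.
move=> rx It sA.
have := ts_interval_near_covering hT (a := a) (b := b) _
  (filter_prod (within A (nbhs t0)) (+oo : set_system R))
  (fun i s => `|k i.1 s (x s)| <= i.2) _.
case=> [s0 Is|[U V] /= [nU [M [_ VM]]] UV].
  apply: (near_sides ha hb) => // B sB.
  have [l kl _] := kernel_side_limit _ _ _ _ _ rx It Is sA sB.
  have [[V U] [/= nV nU] VU] := kl _ ltr01.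
  exists (V, U `*` [set M | `|l| + 1 <= M]) => /=.
    split=> //; exists (U, [set M | `|l| + 1 <= M]) => //=; split=> //.
    exact: nbhs_pinfty_ge.
  move=> [s [t M]] [/= Vs [/= Ut lM]] Bs; apply: le_trans lM.
  have := VU (s, t) (conj Vs Ut) Bs; rewrite /= => h.
  rewrite (_ : k t s (x s) = l - (l - k t s (x s))); last by ring.
  by rewrite (le_trans (ler_normB _ _)) // lerD2l.
exists (M + 1); apply: filterS nU => t Ut.
by apply: (UV (t, M + 1)); split=> //=; apply: VM; rewrite ltrDl.
Qed.

(** The oscillation splits into three thirds: that of [f], the change of the first argument of [k]
    under the integral, and the change of the upper limit of integration. *)
Lemma volterra_rd f x : rd_continuous T a b f -> rd_continuous T a b x ->
  rd_continuous T a b (volterra T a b f k x).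
Proof.
move=> rf rx; apply/rd_continuous_oscP => t0 A e It0 sA e0.
have e3 : 0 < e / 3 by rewrite divr_gt0.
have ba : 0 < b - a by rewrite subr_gt0.
have [M nM] := kernel_bounded _ _ _ rx It0 sA.
have M0 : 0 < `|M| + 1 by rewrite ltr_wpDl.
have [[U1 V1] [/= nU1 nV1] h1] := kernel_equi_osc _ _ _ _ rx It0 sA (divr_gt0 e3 ba).
have /rd_continuous_oscP/(_ _ _ _ It0 sA e3) [[U2 V2] [/= nU2 nV2] h2] := rf.
(* Two points of this ball are at most [e / 3 / (|M| + 1)] apart, so an integrand bounded by [M]
   contributes at most [e / 3] between them. *)
have near_t0 : within A (nbhs t0) (ball t0 (e / 3 / (`|M| + 1) / 2)).
  apply: (@cvg_within _ (nbhs t0) _ A); apply: nbhsx_ballx.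
  by rewrite !divr_gt0.
have nA : within A (nbhs t0) A by exact: withinT.
exists (U1 `&` U2 `&` (ball t0 (e / 3 / (`|M| + 1) / 2) `&` A `&`
           [set t | forall s, IT s -> `|k t s (x s)| <= M]),
        V1 `&` V2 `&` (ball t0 (e / 3 / (`|M| + 1) / 2) `&` A)) => /=.
  split; apply: filterI; try exact: filterI.
  by apply: filterI => //; exact: filterI.
move=> [t t'] [/= [[U1t U2t] [[bt At] Mt]] [[V1t V2t] [bt' At']]].
have It : IT t := side_sub _ _ It0 sA _ At.
have It' : IT t' := side_sub _ _ It0 sA _ At'.
have Ia := ts_interval_left ha hab.
have rk := kernel_section_rd _ _ rx It; have rk' := kernel_section_rd _ _ rx It'.
have /ts_intervalP[at' [t'b _]] := It'.
have d1 : `|delta_integral T a b (fun s => k t s (x s)) a t' -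
            delta_integral T a b (fun s => k t' s (x s)) a t'| <= e / 3.
  have := delta_integral_dist hT ha hb hab _ _ (fun u => e / 3 / (b - a) * u) a t' rk rk'.
  rewrite -mulrBr => h; apply: (le_trans (h _ _ _ _ _)) => //.
  - by move=> u; apply: cvgM; [exact: cvg_cst|exact: cvg_id].
  - move=> s u Is Iu su; rewrite -mulrBr ler_wpM2r ?subr_ge0 ?(ltW su) //.
    exact: (h1 (t, t')).
  by rewrite mulrAC ler_pdivrMr // ler_pM2l // lerD2r.
have d2 : `|delta_integral T a b (fun s => k t s (x s)) a t -
            delta_integral T a b (fun s => k t s (x s)) a t'| <= e / 3.
  rewrite (delta_integral_diff hT ha hb hab) //.
  apply: (le_trans (delta_integral_norm_le hT ha hb hab _ M _ _ rk Mt It' It)).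
  apply: (@le_trans _ _ ((`|M| + 1) * `|t - t'|)).
    by rewrite ler_wpM2r // (le_trans (ler_norm _)) // lerDl.
  rewrite mulrC -ler_pdivlMr //.
  rewrite (_ : t - t' = (t0 - t') - (t0 - t)); last by ring.
  rewrite (le_trans (ler_normB _ _)) // [leRHS]splitr.
  by rewrite lerD // ltW.
have := h2 (t, t') (conj U2t V2t) => /=.
rewrite /volterra /=; move: d1 d2; rewrite !ler_norml.
move=> /andP[? ?] /andP[? ?] /andP[? ?].
by apply/andP; split; lra.
Qed.

Lemma volterra_mono f x y :
  (forall t s, IT t -> IT s -> forall p q, p <= q -> k t s p <= k t s q) ->
  rd_continuous T a b x -> rd_continuous T a b y ->
  (forall t, IT t -> x t <= y t) ->
  forall t, IT t -> volterra T a b f k x t <= volterra T a b f k y t.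
Proof.
move=> mono rx ry xy t It; rewrite lerD2l.
have /ts_intervalP[at_ _] := It.
apply: (delta_integral_mono hT ha hb hab) => //; last exact: ts_interval_left.
- exact: kernel_section_rd.
- exact: kernel_section_rd.
by move=> s Is; apply: mono => //; exact: xy.
Qed.

(** The graph of the exponential lies above its tangent at [t]. This makes the weight usable as [H]
    in [delta_integral_dist]. *)
Lemma expR_weight_slope (c t u : R) : 0 <= c ->
  c * expR (c * (t - a)) * (u - t) <= expR (c * (u - a)) - expR (c * (t - a)).
Proof.
move=> c0; rewrite (_ : c * (u - a) = c * (t - a) + c * (u - t)); last by ring.
rewrite expRD; have := expR_ge1Dx (c * (u - t)).
rewrite -(ler_pM2l (expR_gt0 (c * (t - a)))); lra.
Qed.

(* In the norm weighted by [expR (- (2 * L + 1) * (t - a))] the Volterra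
   operator contracts by a factor 1/2, since L / (2 * L + 1) <= 1/2. *)
Lemma volterra_contraction f x y (L D : R) : 0 <= L -> 0 <= D ->
  (forall t s, IT t -> IT s ->
     forall p q, `|k t s p - k t s q| <= L * `|p - q|) ->
  rd_continuous T a b x -> rd_continuous T a b y ->
  (forall t, IT t -> `|x t - y t| <= D * expR ((2 * L + 1) * (t - a))) ->
  forall t, IT t -> `|volterra T a b f k x t - volterra T a b f k y t|
    <= D / 2 * expR ((2 * L + 1) * (t - a)).
Proof.
move=> L0 D0 lip rx ry xy t It; have /ts_intervalP[at_ _] := It.
set c := 2 * L + 1; have c0 : 0 <= c by rewrite /c; lra.
rewrite /volterra (_ : f t + _ - _ =
  delta_integral T a b (fun s => k t s (x s)) a t -
  delta_integral T a b (fun s => k t s (y s)) a t); last by ring.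
apply: (le_trans (delta_integral_dist hT ha hb hab _ _
  (fun u => D / 2 * expR (c * (u - a))) _ _ _ _ _ _ _ _ _)) => //.
- exact: kernel_section_rd.
- exact: kernel_section_rd.
- move=> u; apply: cvgM; first exact: cvg_cst.
  apply: continuous_comp; last exact: continuous_expR.
  by apply: cvgM; [exact: cvg_cst|apply: cvgB; [exact: cvg_id|exact: cvg_cst]].
- move=> s u Is Iu su; rewrite -mulrBr.
  (* Here [L * D <= D / 2 * c], because [c / 2] is [L + 1 / 2]. *)
  apply: (@le_trans _ _ (D / 2 * (c * expR (c * (s - a)) * (u - s)))); last first.
    by rewrite ler_wpM2l ?divr_ge0 // expR_weight_slope.
  rewrite !mulrA ler_wpM2r ?subr_ge0 ?(ltW su) //.
  apply: (le_trans (lip _ _ It Is _ _)).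
  apply: (le_trans (ler_wpM2l L0 (xy _ Is))); rewrite -/c mulrA ler_wpM2r ?expR_ge0 //.
  by rewrite /c; lra.
- exact: ts_interval_left.
by rewrite lerBlDr lerDl mulr_ge0 ?expR_ge0 // divr_ge0.
Qed.

End Volterra.

(** * Sequences with geometric error bounds *)

Section GeometricBounds.
Context {R : realType}.

Lemma geometric_small (K e : R) : 0 <= K -> 0 < e ->
  exists N, forall n, (N <= n)%N -> K / 2 ^+ n <= e.
Proof.
move=> K0 e0; exists (Num.Def.archi_bound (K / e)) => n Nn.
have Ke : 0 <= K / e by rewrite divr_ge0 // ltW.
rewrite ler_pdivrMr ?exprn_gt0 // mulrC -ler_pdivrMr //.
apply: (le_trans (ltW (archi_boundP Ke))).
rewrite -natrX ler_nat; apply: (leq_trans Nn); apply: ltnW; exact: ltn_expl.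
Qed.

Lemma geometric_squeeze (K z : R) : (forall n, `|z| <= K / 2 ^+ n) -> z = 0.
Proof.
move=> h; have K0 : 0 <= K by have := le_trans (normr_ge0 _) (h 0%N); rewrite expr0 divr1.
apply/normr0_eq0/le_anti/andP; split => //; apply/ler_addgt0Pr => e e0.
have [N hN] := geometric_small _ _ K0 e0.
by rewrite add0r (le_trans (h N)) // hN.
Qed.

Lemma geometric_cauchy (u : nat -> R) (K : R) :
  (forall n, `|u n.+1 - u n| <= K / 2 ^+ n) ->
  forall n m, `|u (n + m)%N - u n| <= 2 * K / 2 ^+ n.
Proof.
move=> h n m.
have K0 : 0 <= K by have := le_trans (normr_ge0 _) (h 0%N); rewrite expr0 divr1.
(* The exact partial sum of the geometric series is what the induction on [m] can carry. *)
suff : `|u (n + m)%N - u n| <= 2 * K / 2 ^+ n - 2 * K / 2 ^+ (n + m).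
  by move=> /le_trans; apply; rewrite gerBl divr_ge0 ?mulr_ge0 ?exprn_ge0.
elim: m => [|m IH]; first by rewrite addn0 !subrr normr0.
rewrite addnS (_ : _ - u n = (u (n + m).+1 - u (n + m)%N) + (u (n + m)%N - u n)); last by ring.
apply: (le_trans (ler_normD _ _)).
have := h (n + m)%N.
have -> : 2 * K / 2 ^+ (n + m).+1 = K / 2 ^+ (n + m).
  by rewrite exprS invfM mulrA [2 * K]mulrC mulfK.
move: IH; rewrite -!mulrA; lra.
Qed.

Lemma geometric_limit (u : nat -> R) (K : R) :
  (forall n, `|u n.+1 - u n| <= K / 2 ^+ n) ->
  forall n, `|lim (u @ \oo) - u n| <= 2 * K / 2 ^+ n.
Proof.
move=> h n; have uC := geometric_cauchy _ _ h.
have K0 : 0 <= K by have := le_trans (normr_ge0 _) (h 0%N); rewrite expr0 divr1.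
have K2 : 0 <= 2 * K by rewrite mulr_ge0.
(* Convergence has to come first, since [lim] is an arbitrary value without it. *)
have : exists l : R, u x @[x --> \oo] --> l.
  apply: osc_cvg => e e0; have e2 : 0 < e / 2 by rewrite divr_gt0.
  have [N hN] := geometric_small _ _ K2 e2.
  exists ([set p | (N <= p)%N], [set p | (N <= p)%N]) => /=.
    by split; exact: nbhs_infty_ge.
  move=> [p q] [/= Np Nq].
  rewrite (_ : u p - u q = (u p - u N) - (u q - u N)); last by ring.
  rewrite (le_trans (ler_normB _ _)) // [leRHS]splitr lerD //.
    by rewrite -(subnKC Np) (le_trans (uC _ _)) // hN.
  by rewrite -(subnKC Nq) (le_trans (uC _ _)) // hN.
move=> [l ul]; rewrite (cvg_lim _ ul) //.
apply/ler_addgt0Pr => e e0.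
move/cvgrPdist_le: ul => /(_ _ e0) [N _ /(_ (n + N)%N (leq_addl _ _)) lN].
rewrite (_ : l - u n = (u (n + N)%N - u n) + (l - u (n + N)%N)); last by ring.
by rewrite (le_trans (ler_normD _ _)) // lerD.
Qed.

End GeometricBounds.

Theorem theorem4 (R : realType) (T : set R) (a b : R)
  (hT : time_scale T) (ha : T a) (hb : T b) (hab : a < b)
  (f : R -> R) (hf : rd_continuous T a b f)
  (k : R -> R -> R -> R) (hk : rd_continuous3 T a b k)
  (hkmono : forall t s : R, ts_interval T a b t -> ts_interval T a b s ->
     forall p q : R, p <= q -> k t s p <= k t s q)
  (hkLip : exists2 L : R, 0 <= L &
     forall t s : R, ts_interval T a b t -> ts_interval T a b s ->
     forall p q : R, `|k t s p - k t s q| <= L * `|p - q|)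
  (v w : R -> R) (hv : rd_continuous T a b v) (hw : rd_continuous T a b w)
  (hvlow : is_lower_solution T a b f k v)
  (hwup : is_upper_solution T a b f k w)
  (hvw : forall t : R, ts_interval T a b t -> v t <= w t)
  (xs : nat -> R -> R)
  (hxs0 : forall t : R, ts_interval T a b t -> xs 0%N t = volterra T a b f k v t)
  (hxsS : forall (n : nat) (t : R), ts_interval T a b t ->
     xs n.+1 t = volterra T a b f k (xs n) t) :
  exists x : R -> R,
    [/\ rd_continuous T a b x,
        is_solution T a b f k x,
        (forall y : R -> R, rd_continuous T a b y -> is_solution T a b f k y ->
           forall t : R, ts_interval T a b t -> y t = x t),
        {uniform ts_interval T a b, xs n @[n --> \oo] --> x} &
        (forall t : R, ts_interval T a b t -> v t <= x t <= w t)].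
Proof.
have [L L0 lip] := hkLip.
set IT := ts_interval T a b.
pose V := volterra T a b f k; pose E t := expR ((2 * L + 1) * (t - a)).
have rV x : rd_continuous T a b x -> rd_continuous T a b (V x).
  exact: volterra_rd.
have rxs n : rd_continuous T a b (xs n).
  elim: n => [|n IH]; first exact: eq_rd_continuous _ _ hxs0 (rV _ hv).
  exact: eq_rd_continuous _ _ (hxsS n) (rV _ IH).
(* The weight lies between 1 and [E b], so weighted and uniform bounds can be exchanged. *)
have E1 t : IT t -> 1 <= E t.
  move=> /ts_intervalP[at_ _]; rewrite -(expR0 R) ler_expR.
  by rewrite mulr_ge0 ?subr_ge0 // addr_ge0 // mulr_ge0.
have EB t : IT t -> E t <= E b.
  move=> /ts_intervalP[_ [tb _]]; rewrite ler_expR ler_wpM2l ?lerD2r //.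
  by rewrite addr_ge0 // mulr_ge0.
have contr x y D : 0 <= D -> rd_continuous T a b x -> rd_continuous T a b y ->
    (forall t, IT t -> `|x t - y t| <= D * E t) ->
    forall t, IT t -> `|V x t - V y t| <= D / 2 * E t.
  by move=> D0 rx ry; apply: (volterra_contraction hT ha hb hab k hk f x y L D).
have dist_bound x y : rd_continuous T a b x -> rd_continuous T a b y ->
    exists2 D, 0 <= D & forall t, IT t -> `|x t - y t| <= D * E t.
  move=> /(rd_bounded hT ha hb)[M M0 xM] /(rd_bounded hT ha hb)[N N0 yN].
  exists (M + N); first exact: addr_ge0.
  move=> t It; rewrite (le_trans (ler_normB _ _)) //.
  by rewrite (le_trans (lerD (xM _ It) (yN _ It))) // ler_peMr ?E1 ?addr_ge0.
have halfS (D : R) n : D / 2 ^+ n / 2 = D / 2 ^+ n.+1.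
  by rewrite exprSr invfM mulrA mulrAC.
have D2 (D : R) n : 0 <= D -> 0 <= D / 2 ^+ n.
  by move=> D0; rewrite divr_ge0 ?exprn_ge0.
have [D D0 vD] := dist_bound _ _ (rxs 0%N) hv.
(* As [xs 0] is the image of [v], the distance [D] between them is already halved at [n = 0]. *)
have step n t : IT t -> `|xs n.+1 t - xs n t| <= D / 2 ^+ n.+1 * E t.
  elim: n t => [|n IH] t It.
    by rewrite hxsS // hxs0 // expr1; exact: contr.
  by rewrite !hxsS // -halfS; apply: contr => //; exact: D2.
(* [D * E b] bounds the steps without weight; the factor 2 is that of [geometric_limit]. *)
pose K := 2 * (D * E b).
have K0 : 0 <= K by rewrite !mulr_ge0 // expR_ge0.
pose x t := lim (xs n t @[n --> \oo]).
have xK t n : IT t -> `|x t - xs n t| <= K / 2 ^+ n.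
  move=> It; apply: geometric_limit => {}n; apply: (le_trans (step n t It)).
  rewrite [leRHS]mulrAC ler_pM ?D2 ?expR_ge0 ?EB //.
  by rewrite -halfS ler_pdivrMr // ler_peMr ?D2 // ler1n.
have rx : rd_continuous T a b x.
  apply: (rd_uniform_limit xs) => // e e0.
  by have [N hN] := geometric_small _ _ K0 e0; exists N => t It; rewrite (le_trans (xK _ _ It)) // hN.
have xsol : is_solution T a b f k x.
  move=> t It; apply/eqP; rewrite -subr_eq0; apply/eqP.
  (* The term [K] bounds the distance from [x] to the next iterate, [K * E b] that between the
     images of [xs n] and [x]. *)
  apply: (geometric_squeeze (K + K * E b)) => n.
  rewrite (_ : _ - _ = (x t - xs n.+1 t) + (V (xs n) t - V x t)); last first.
    by rewrite /V -hxsS //; ring.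
  rewrite (le_trans (ler_normD _ _)) // mulrDl lerD //.
    by rewrite (le_trans (xK _ _ It)) // -halfS ler_pdivrMr // ler_peMr ?D2 // ler1n.
  have xn s : IT s -> `|xs n s - x s| <= K / 2 ^+ n * E s.
    by move=> Is; rewrite distrC (le_trans (xK _ _ Is)) // ler_peMr ?E1 ?D2.
  apply: (le_trans (contr _ _ _ (D2 K n K0) (rxs n) rx xn t It)).
  rewrite [leRHS]mulrAC ler_pM ?EB ?expR_ge0 // ?divr_ge0 ?D2 //.
  by rewrite ler_pdivrMr // ler_peMr ?D2 // ler1n.
have le_lim (y z : R) t : IT t -> (forall n, y <= xs n t <= z) -> y <= x t <= z.
  move=> It yz; apply/andP; split; apply/ler_addgt0Pr => e e0;
    have [N /(_ N (leqnn N)) hN] := geometric_small _ _ K0 e0;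
    have /andP[yx xz] := yz N; have := le_trans (xK t N It) hN;
    rewrite ler_norml => /andP[]; lra.
exists x; split=> //.
- move=> y ry ysol t It; apply/eqP; rewrite -subr_eq0; apply/eqP.
  have [M M0 yM] := dist_bound _ _ ry rx.
  (* Both functions are fixed points, so each application of the contraction halves the bound on
     their distance. *)
  suff yx n s : IT s -> `|y s - x s| <= M / 2 ^+ n * E s.
    by apply: (geometric_squeeze (M * E t)) => n; rewrite mulrAC yx.
  elim: n s => [|n IH] s Is; first by rewrite expr0 divr1 yM.
  by rewrite ysol // xsol // -halfS; apply: contr => //; exact: D2.
- move=> P /uniform_nbhs[U [entU UP]].
  move: entU; rewrite -entourage_ballE => -[e /= e0 eU].
  (* Half of [e], because the ball is defined by a strict inequality. *)
  have e2 : 0 < e / 2 by rewrite divr_gt0.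
  have [N hN] := geometric_small _ _ K0 e2.
  exists N => // n /= Nn; apply: UP => t It; apply: eU => /=.
  rewrite /ball/=; apply: (le_lt_trans (xK t n It)).
  by rewrite (le_lt_trans (hN _ Nn)) // ltr_pdivrMr // ltr_pMr // ltr1n.
(* At [n = 0] the lower bound is the hypothesis on [v] itself, and the upper one uses [v <= w]
   before applying the operator. *)
- move=> t It; apply: le_lim => // n; elim: n t It => [|n IH] t It.
    rewrite hxs0 // hvlow //= (le_trans _ (hwup _ It)) //.
    exact: (volterra_mono hT ha hb hab k hk f v w).
  rewrite hxsS //; apply/andP; split.
    apply: (le_trans (hvlow _ It)).
    by apply: (volterra_mono hT ha hb hab k hk f v (xs n)) => // s /IH/andP[].
  apply: (le_trans _ (hwup _ It)).
  by apply: (volterra_mono hT ha hb hab k hk f (xs n) w) => // s /IH/andP[].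
Qed.
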